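(* Let $G=(V,E)$ be a finite undirected weighted graph with $V=\{1,\dots,n\}$ and all degrees $d_i>0$, let $d\ge1$, and let $\rho:E\to O(d)$ be given with $\rho_{ji}=\rho_{ij}^{-1}$. Let $\eta_G$ be the $\mathbb{S}^{d-1}$ frustration constant of $G$, $\lambda_1(\mathcal{L}_1)$ the smallest eigenvalue of the normalized graph Connection Laplacian, and $\lambda_2(\mathcal{L}_0)$ the second smallest eigenvalue of the normalized graph Laplacian, and assume $\lambda_2(\mathcal{L}_0)>0$. Then $$\lambda_1(\mathcal{L}_1)\le\eta_G\le 44\,\frac{\lambda_1(\mathcal{L}_1)}{\lambda_2(\mathcal{L}_0)}.$$
   Context: $G$ is a simple graph with symmetric weights $w_{ij}=w_{ji}$, $w_{ij}>0$ if $(i,j)\in E$ and $w_{ij}=0$ otherwise; $d_i=\sum_j w_{ij}$. $O(d)$ is the group of $d\times d$ real orthogonal matrices; $\mathbb{S}^{d-1}$ is the unit sphere in $\mathbb{R}^d$. Sums $\sum_{i,j}$ run over all ordered pairs of vertices (terms with $w_{ij}=0$ vanish). Graph Laplacian: $W_0=(w_{ij})\in\mathbb{R}^{n\times n}$, $D_0=\mathrm{diag}(d_1,\dots,d_n)$, $\mathcal{L}_0=I-D_0^{-1/2}W_0D_0^{-1/2}$. Connection Laplacian: $W_1\in\mathbb{R}^{dn\times dn}$ is the symmetric matrix whose $(i,j)$-th $d\times d$ block is $w_{ij}\rho_{ij}$, $D_1\in\mathbb{R}^{dn\times dn}$ is block diagonal with $i$-th diagonal block $d_iI_{d\times d}$,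 and $\mathcal{L}_1=I-D_1^{-1/2}W_1D_1^{-1/2}$. Eigenvalues are listed in increasing order with multiplicity. For $v:V\to\mathbb{R}^d$ not identically zero, its frustration is $$\eta(v)=\frac12\,\frac{\sum_{i,j}w_{ij}\|v_i-\rho_{ij}v_j\|^2}{\sum_i d_i\|v_i\|^2},$$ and $\eta_G=\min_{v:V\to\mathbb{S}^{d-1}}\eta(v)$. *)

(* Defs.v *)
From mathcomp Require Import all_boot all_order all_algebra.
From mathcomp Require Import all_classical all_reals all_analysis.
From mathcomp Require Import polyrcf.
Set Implicit Arguments.
Unset Strict Implicit.
Unset Printing Implicit Defensive.
Import Order.TTheory GRing.Theory Num.Theory.
Import numFieldNormedType.Exports.
Local Open Scope classical_set_scope.
Local Open Scope ring_scope.

(* [rootsR p] lists the distinct real roots of [p] in increasing order; each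
   is repeated here according to its multiplicity.  For a symmetric matrix of
   size [n] all [n] eigenvalues are real, so the list has length [n]. *)
Definition eigenvalues (R : rcfType) (n : nat) (A : 'M[R]_n) : seq R :=
  flatten [seq nseq (mup x (char_poly A)) x | x <- rootsR (char_poly A)].

(* The [k]-th smallest eigenvalue, counted from [k = 1] as is usual. *)
Definition lambda (R : rcfType) (n : nat) (k : nat) (A : 'M[R]_n) : R :=
  nth 0 (eigenvalues A) k.-1.

(* [D^{-1/2}] for a diagonal [D] with positive diagonal entries: since
   [(Num.sqrt 0)^-1 = 0], the zero entries off the diagonal are unchanged. *)
Definition diag_invsqrt (R : rcfType) (n : nat) (D : 'M[R]_n) : 'M[R]_n :=
  map_mx (fun x => (Num.sqrt x)^-1) D.

Definition normalized_laplacian (R : rcfType) (n : nat) (W D : 'M[R]_n) :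
    'M[R]_n :=
  1%:M - diag_invsqrt D *m W *m diag_invsqrt D.

Definition degree (R : rcfType) (n : nat) (w : 'I_n -> 'I_n -> R) (i : 'I_n) :
    R :=
  \sum_j w i j.

Definition graph_laplacian (R : rcfType) (n : nat) (w : 'I_n -> 'I_n -> R) :
    'M[R]_n :=
  normalized_laplacian (\matrix_(i, j) w i j) (diag_mx (\row_i degree w i)).

Definition connection_laplacian (R : rcfType) (n d : nat)
    (w : 'I_n -> 'I_n -> R) (rho : 'I_n -> 'I_n -> 'M[R]_d) :
    'M[R]_(\sum_(i < n) d) :=
  normalized_laplacian (\mxblock_(i < n, j < n) (w i j *: rho i j))
                       (\mxdiag_(i < n) (degree w i)%:M).

Definition orthogonal_mx (R : rcfType) (d : nat) (A : 'M[R]_d) : Prop :=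
  A^T *m A = 1%:M.

(* The library norm on matrices is the sup norm, hence this definition. *)
Definition enorm (R : rcfType) (d : nat) (u : 'cV[R]_d) : R :=
  Num.sqrt (\sum_k u k 0 ^+ 2).

Definition frustration (R : rcfType) (n d : nat) (w : 'I_n -> 'I_n -> R)
    (rho : 'I_n -> 'I_n -> 'M[R]_d) (v : 'I_n -> 'cV[R]_d) : R :=
  2^-1 * ((\sum_i \sum_j w i j * enorm (v i - rho i j *m v j) ^+ 2)
          / (\sum_i degree w i * enorm (v i) ^+ 2)).

Definition sphere_valued (R : rcfType) (n d : nat) (v : 'I_n -> 'cV[R]_d) :
    Prop :=
  forall i, enorm (v i) = 1.

(* This infimum is a minimum by [frustration_constant_min] below. *)
Definition frustration_constant (R : realType) (n d : nat)
    (w : 'I_n -> 'I_n -> R) (rho : 'I_n -> 'I_n -> 'M[R]_d) : R :=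
  inf [set frustration w rho v | v in @sphere_valued R n d].

Section FrustrationConstantMin.
Variables (R : realType) (n d : nat).
Variables (w : 'I_n -> 'I_n -> R) (rho : 'I_n -> 'I_n -> 'M[R]_d).

Let dec (x : 'rV[R]_(n * d)) (i : 'I_n) : 'cV[R]_d :=
  \col_k vec_mx x i k.

Let enc (v : 'I_n -> 'cV[R]_d) : 'rV[R]_(n * d) :=
  mxvec (\matrix_(i, k) v i k 0).

Let encK v : dec (enc v) = v.
Proof.
by apply/funext => i; apply/matrixP => k j; rewrite mxE mxvecK mxE (ord1 j).
Qed.

Let enorm_sqr m (u : 'cV[R]_m) : enorm u ^+ 2 = \sum_k u k 0 ^+ 2.
Proof. by rewrite sqr_sqrtr// sumr_ge0// => k _; exact: sqr_ge0. Qed.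

Let dec_continuous i k : continuous (fun x => dec x i k 0).
Proof.
have -> : (fun x => dec x i k 0) =
    (fun x : 'rV[R]_(n * d) => x ord0 (mxvec_index i k)).
  by apply/funext => x; rewrite !mxE.
exact: coord_continuous.
Qed.

Let sum_continuous (m : nat) (f : 'I_m -> 'rV[R]_(n * d) -> R) :
  (forall i, continuous (f i)) -> continuous (fun x => \sum_i f i x).
Proof.
move=> cf; apply: continuous_big => [|i _]; last exact: cf.
exact: add_continuous.
Qed.

Let mul_continuous (f g : 'rV[R]_(n * d) -> R) :
  continuous f -> continuous g -> continuous (fun x => f x * g x).
Proof. by move=> cf cg x; exact: (cvgM (cf x) (cg x)). Qed.

Let sub_continuous (f g : 'rV[R]_(n * d) -> R) :
  continuous f -> continuous g -> continuous (fun x => f x - g x).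
Proof. by move=> cf cg x; exact: (cvgB (cf x) (cg x)). Qed.

Let sqr_continuous (f : 'rV[R]_(n * d) -> R) :
  continuous f -> continuous (fun x => f x ^+ 2).
Proof. by move=> cf; under eq_fun do rewrite expr2; exact: mul_continuous. Qed.

Let sphere_dec i : closed [set x | enorm (dec x i) = 1].
Proof.
have -> : [set x | enorm (dec x i) = 1] =
    (fun x => \sum_k dec x i k 0 ^+ 2) @^-1` [set 1].
  apply/seteqP; split => x /=.
    by rewrite -enorm_sqr => ->; rewrite expr1n.
  by rewrite /enorm => ->; rewrite sqrtr1.
apply: preimage_closed; last exact: closed_eq.
by move=> x _; apply: sum_continuous => k; exact/sqr_continuous/dec_continuous.
Qed.

Let sphere_compact : compact [set x | sphere_valued (dec x)].
Proof.
apply: bounded_closed_compact; last first.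
  have -> : [set x | sphere_valued (dec x)] =
      \bigcap_(i in setT) [set x | enorm (dec x i) = 1].
    by apply/seteqP; split => x /= h i; [move=> _|]; exact: h.
  by apply: closed_bigI => i _; exact: sphere_dec.
exists 1; split => // M M1 x /= hx.
rewrite [leLHS]/Num.norm /= mx_normrE.
apply/bigmax_leP; split; first exact: ltW (lt_trans ltr01 M1).
move=> [a b] _ /=; rewrite (ord1 a) {a}.
case/mxvec_indexP: b => i k.
have -> : x 0 (mxvec_index i k) = dec x i k 0 by rewrite !mxE.
apply: le_trans (ltW M1); rewrite -(hx i) -sqrtr_sqr ler_wsqrtr//.
by rewrite (bigD1 k)//= lerDl sumr_ge0// => l _; exact: sqr_ge0.
Qed.

Lemma frustration_constant_min : (0 < d)%N ->
  exists2 v : 'I_n -> 'cV[R]_d, sphere_valued v &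
    frustration_constant w rho = frustration w rho v /\
    forall u : 'I_n -> 'cV[R]_d, sphere_valued u ->
      frustration w rho v <= frustration w rho u.
Proof.
move=> d0.
pose c := \sum_i degree w i.
pose g (x : 'rV[R]_(n * d)) := 2^-1 *
  ((\sum_i \sum_j w i j *
     \sum_k (dec x i k 0 - \sum_l rho i j k l * dec x j l 0) ^+ 2) / c).
have gE v : sphere_valued v -> frustration w rho v = g (enc v).
  move=> hv; rewrite /frustration /g encK; congr (_ * (_ / _)).
    apply: eq_bigr => i _; apply: eq_bigr => j _; rewrite enorm_sqr.
    by congr (_ * _); apply: eq_bigr => k _; rewrite !mxE.
  by apply: eq_bigr => i _; rewrite hv expr1n mulr1.
have cg : continuous g.
  have cst a : continuous (fun _ : 'rV[R]_(n * d) => a : R).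
    exact: cst_continuous.
  have cin i j k : continuous (fun x =>
      (dec x i k 0 - \sum_l rho i j k l * dec x j l 0) ^+ 2).
    apply: sqr_continuous; refine (sub_continuous (@dec_continuous _ _) _).
    apply: sum_continuous => l.
    exact: (mul_continuous (cst _) (@dec_continuous _ _)).
  refine (mul_continuous (cst _) _).
  refine (mul_continuous _ (cst _)).
  apply: sum_continuous => i; apply: sum_continuous => j.
  refine (mul_continuous (cst _) _).
  by apply: sum_continuous => k; exact: cin.
have [|x sx gx] := EVT_min_rV _ sphere_compact (continuous_subspaceT cg).
  exists (enc (fun=> delta_mx (Ordinal d0) 0)) => /=; rewrite encK => i.
  rewrite /enorm (bigD1 (Ordinal d0))//= big1 ?addr0 => [|k kN0].
    by rewrite mxE !eqxx expr1n sqrtr1.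
  by rewrite mxE (negbTE kN0) expr0n.
have sv : sphere_valued (dec x) by exact: (set_mem sx).
have minv u : sphere_valued u ->
    frustration w rho (dec x) <= frustration w rho u.
  move=> su; rewrite !gE//.
  have -> : enc (dec x) = x.
    rewrite -[RHS]vec_mxK; congr mxvec.
    by apply/matrixP => i k; rewrite !mxE.
  by apply: gx; rewrite inE /= encK.
exists (dec x) => //; split=> //.
apply/le_anti/andP; split.
  apply: ge_inf; last by exists (dec x).
  by exists (frustration w rho (dec x)) => _ [u su <-]; exact: minv.
apply: lb_le_inf; first by exists (frustration w rho (dec x)), (dec x).
by move=> _ [u su <-]; exact: minv.
Qed.

End FrustrationConstantMin.

(* Main.v *)
(* Let [x] be an eigenvector for the smallest eigenvalue of the connection
   Laplacian, read as a vector field on the vertices, and round it to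
   [u i = x i / |x i|], with an arbitrary unit vector where [x i] vanishes.
   Since the [rho i j] are isometries, the energy of the function
   [f i = |x i|] is at most that of [x], so by the Poincare inequality on the
   graph [f] is close in variance to its mean [m].  From
   [m u = x + (m - f) u] at both endpoints of an edge,
     [m |u i - rho i j u j| <= |x i - rho i j x j| + |f i - m| + |f j - m|],
   and summing squares bounds the frustration of [u].  With
   [r = lambda1 / lambda2] this gives [(1 - r) eta <= 9 r], hence
   [eta <= 11 r] because always [eta <= 2]. *)
Require Import Defs.
From mathcomp Require Import all_boot all_order all_algebra.
From mathcomp Require Import all_classical all_reals all_analysis.
From mathcomp Require Import complex polyrcf spectral sesquilinear ring lra.
Set Implicit Arguments.
Unset Strict Implicit.
Unset Printing Implicit Defensive.
Import Order.TTheory GRing.Theory Num.Theory.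
Local Open Scope ring_scope.

(** * Spectra of real symmetric matrices and their variational bounds *)

Lemma char_poly_similar (F : fieldType) n (P A : 'M[F]_n) :
  P \in unitmx -> char_poly (invmx P *m A *m P) = char_poly A.
Proof.
move=> uP; rewrite /char_poly /char_poly_mx.
have {1}-> : 'X%:M = map_mx polyC (invmx P) *m 'X%:M *m map_mx polyC P.
  by rewrite scalar_mxC -mulmxA -map_mxM mulVmx// map_mx1 mulmx1.
rewrite !map_mxM -mulmxBl -mulmxBr !det_mulmx mulrAC -det_mulmx -map_mxM.
by rewrite mulVmx// map_mx1 det1 mul1r.
Qed.

Section Spectral.
Variable R : rcfType.

Lemma sorted_flatten_nseq (m : R -> nat) (s : seq R) :
  sorted <%R s -> sorted <=%R (flatten [seq nseq (m x) x | x <- s]).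
Proof.
rewrite lt_sorted_pairwise le_sorted_pairwise.
elim: s => //= x s IH /andP[xs /IH ps]; rewrite pairwise_cat ps andbT.
apply/andP; split; last first.
  by elim: (m x) => //= k ->; rewrite andbT all_nseq lexx orbT.
apply/allrelP => y z /nseqP[-> _] /flatten_mapP[t ts /nseqP[-> _]].
by rewrite ltW// (allP xs).
Qed.

Lemma count_flatten_nseq (m : R -> nat) (s : seq R) x :
  uniq s ->
  count_mem x (flatten [seq nseq (m y) y | y <- s]) = ((x \in s) * m x)%N.
Proof.
elim: s => //= y s IH /andP[ys us].
rewrite count_cat IH// count_nseq in_cons /= eq_sym.
by have [->|//] := eqVneq x y; rewrite (negbTE ys) mul0n addn0.
Qed.

Lemma mup_prod_XsubC (s : seq R) x :
  mup x (\prod_(a <- s) ('X - a%:P)) = count_mem x s.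
Proof.
elim: s => [|a s IH]; first by rewrite big_nil mupNroot// root1.
rewrite big_cons mupM ?polyXsubC_eq0 ?monic_neq0 ?monic_prod_XsubC// IH /=.
by rewrite -['X - _]expr1 mup_XsubCX; case: eqP.
Qed.

Lemma eigenvalues_sorted n (A : 'M[R]_n) : sorted <=%R (eigenvalues A).
Proof. exact/sorted_flatten_nseq/sorted_roots. Qed.

(** In both lists a number occurs as often as its multiplicity as a root of the characteristic
    polynomial. *)
Lemma perm_eigenvalues n (A : 'M[R]_n) (a : 'I_n -> R) :
  char_poly A = \prod_i ('X - (a i)%:P) -> perm_eq (eigenvalues A) (codom a).
Proof.
move=> cA; apply/allP => x _ /=; apply/eqP.
have cA0 : char_poly A != 0 by rewrite monic_neq0// char_poly_monic.
rewrite count_flatten_nseq ?uniq_roots// -mup_prod_XsubC.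
rewrite big_map big_enum/= -cA.
have := roots_on_rootsR cA0 x; rewrite in_itv /= => <-.
by have [_|/mupNroot->//] := boolP (root _ _); rewrite mul1n.
Qed.

Local Notation toC := (map_mx (real_complex R)).
Local Open Scope sesquilinear_scope.

Lemma real_trmxC m n (M : 'M[R]_(m, n)) : (toC M)^t* = toC M^T.
Proof. by apply/matrixP => i j; rewrite !mxE; exact: conjc_real. Qed.

(** Over the complex numbers [A] is hermitian, so the spectral theorem diagonalizes it with a real
    diagonal. The factorization of the characteristic polynomial then descends to [R], because the
    embedding of [R] is injective. *)
Lemma symmetric_spectral n (A : 'M[R]_n) : A^T = A ->
  exists P : 'M[R[i]]_n, exists a : 'I_n -> R,
    [/\ P \is unitarymx,
        toC A = P^t* *m diag_mx (\row_i (a i)%:C%C) *m P &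
        char_poly A = \prod_i ('X - (a i)%:P)].
Proof.
move=> AT.
have hA : toC A \is hermsymmx.
  apply/is_hermitianmxP; rewrite expr0 scale1r.
  by rewrite real_trmxC AT.
have /orthomx_spectralP := hermitian_normalmx hA.
have /mxOverP/(_ ord0) := hermitian_spectral_diag_real hA.
set P := spectralmx _; set D := spectral_diag _ => Dr.
have uP : P \is unitarymx := spectral_unitarymx _.
have iP : P \in unitmx := unitarymx_unit uP.
have -> : D = \row_i (complex.Re (D 0 i))%:C%C.
  by apply/rowP => i; rewrite mxE RRe_real// Dr.
move=> AE; exists P, (fun i => complex.Re (D 0 i)); split => //.
  by rewrite -invmx_unitary.
apply: (map_poly_inj (real_complex R)).
rewrite map_char_poly AE rmorph_prod/=.
set E := diag_mx _ in AE *.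
rewrite char_poly_similar//.
rewrite char_poly_trig ?diag_mx_is_trig//; apply: eq_bigr => i _.
by rewrite !mxE eqxx rmorphB/= map_polyX map_polyC.
Qed.

Definition dot n (x y : 'rV[R]_n) : R := (x *m y^T) 0 0.

Lemma dotE n (x y : 'rV[R]_n) : dot x y = \sum_i x 0 i * y 0 i.
Proof. by rewrite /dot mxE; apply: eq_bigr => i _; rewrite mxE. Qed.

Lemma dot_eq0 n (x : 'rV[R]_n) : (dot x x == 0) = (x == 0).
Proof.
rewrite dotE psumr_eq0 => [|i _]; last by rewrite -expr2 sqr_ge0.
apply/allP/eqP => [x0|-> i _]; last by rewrite /= mxE mulr0.
apply/rowP => i; apply/eqP; have /= := x0 i (mem_index_enum i).
by rewrite mulf_eq0 orbb mxE.
Qed.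

(** [c x] lists the complex coordinates of [x] in an orthonormal eigenbasis. Later proofs need only
    Parseval's identity, the coordinates of zero and the diagonal action of [A]. *)
Lemma spectral_coordinates n (A : 'M[R]_n) : A^T = A ->
  exists a : 'I_n -> R, exists c : 'rV[R]_n -> 'I_n -> R[i],
    [/\ char_poly A = \prod_i ('X - (a i)%:P),
        forall x y, (dot x y)%:C%C = \sum_i c x i * (c y i)^*,
        forall i, c 0 i = 0 &
        forall x i, c (x *m A) i = (a i)%:C%C * c x i].
Proof.
move=> /symmetric_spectral[P [a [uP AE cA]]].
exists a, (fun x i => (toC x *m P^t*) 0 i).
split => [//|x y|i|x i]; last 1 first.
- rewrite map_mxM AE !mulmxA -[_ *m P *m _]mulmxA.
  by rewrite (unitarymxP uP) mulmx1 mul_mx_diag mxE [X in _ * X]mxE mulrC.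
- have -> : (dot x y)%:C%C = ((toC x *m P^t*) *m (toC y *m P^t*)^t*) 0 0.
      rewrite trmx_mul map_mxM trmxCK real_trmxC mulmxA.
      rewrite -[X in X *m toC _]mulmxA.
      rewrite -{1}(invmx_unitary uP) mulVmx ?unitarymx_unit// mulmx1 -map_mxM.
      by rewrite mxE.
    by rewrite mxE; apply: eq_bigr => i _; rewrite !mxE.
- by rewrite map_mx0 mul0mx mxE.
Qed.

Lemma size_eigenvalues n (A : 'M[R]_n) : A^T = A -> size (eigenvalues A) = n.
Proof.
move=> /spectral_coordinates[a [c [/perm_eigenvalues/perm_size-> _ _ _]]].
by rewrite size_codom card_ord.
Qed.

Lemma lambda1_le_dot n (A : 'M[R]_n) (x : 'rV[R]_n) : A^T = A ->
  lambda 1 A * dot x x <= dot (x *m A) x.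
Proof.
move=> /spectral_coordinates[a [c [/perm_eigenvalues pa cD _ cA]]].
rewrite -lecR rmorphM/= !cD mulr_sumr; apply: ler_sum => i _.
rewrite cA -mulrA ler_wpM2r ?mul_conjC_ge0// lecR /lambda.
have : a i \in eigenvalues A by rewrite (perm_mem pa) codom_f.
have := eigenvalues_sorted A; case: eigenvalues => //= t s ts.
rewrite inE => /predU1P[->//|]; apply/allP/order_path_min => //.
exact: le_trans.
Qed.

Lemma lambda_eigenvector n k (A : 'M[R]_n) : A^T = A -> (k.-1 < n)%N ->
  exists2 x : 'rV[R]_n, x != 0 & x *m A = lambda k A *: x.
Proof.
move=> AT kn.
have [a [c [cA _ _ _]]] := spectral_coordinates AT.
suff : eigenvalue A (lambda k A) by move=> /eigenvalueP[x xA x0]; exists x.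
rewrite eigenvalue_root_char cA.
(* The bound on [k] makes [lambda k A] a true entry of the list and not the default 0 of [nth]. *)
have : lambda k A \in codom a.
  by rewrite -(perm_mem (perm_eigenvalues cA)) mem_nth// size_eigenvalues.
move=> /codomP[i ->].
by rewrite /root horner_prod (bigD1 i)//= !hornerE subrr mul0r.
Qed.

(** The kernel vector [u] has a nonzero coordinate [i0], whose eigenvalue is 0. No other eigenvalue
    lies below [lambda 2 A], so [u] is supported on [i0] alone. Orthogonality to [u] then kills that
    coordinate of [x], and all remaining eigenvalues are at least [lambda 2 A]. *)
Lemma lambda2_le_dot n (A : 'M[R]_n) (u x : 'rV[R]_n) : A^T = A ->
  u != 0 -> u *m A = 0 -> 0 < lambda 2 A -> dot x u = 0 ->
  lambda 2 A * dot x x <= dot (x *m A) x.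
Proof.
move=> AT u0 uA l2 xu.
have [a [c [cA cD c0 cM]]] := spectral_coordinates AT.
have pa := perm_eigenvalues cA.
(* In a sorted list at most one entry, the first, lies strictly below the second. The count
   transfers to the indices of [a] by permutation. *)
have le2 i j : a i < lambda 2 A -> a j < lambda 2 A -> i = j.
  suff /card_le1_eqP h : (#|[pred i | (a i < lambda 2 A)%R]| <= 1)%N.
    by move=> ai aj; apply: h; rewrite inE.
  rewrite -sum1_card -(big_enum_cond _ _ predT).
  rewrite -(big_map a (fun t => t < lambda 2 A) (fun=> 1%N)).
  rewrite sum1_count -(permP pa) /lambda/=.
  have := eigenvalues_sorted A; case: eigenvalues => // t [|t' s] /=.
    by case: (_ < _).
  move=> /andP[tt' ts]; rewrite ltxx add0n.
  rewrite (_ : count _ s = 0%N) ?addn0 ?leq_b1//.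
  apply/eqP; rewrite -leqn0 leqNgt -has_count -all_predC.
  apply: sub_all (order_path_min le_trans ts) => y /= ty.
  by rewrite -leNgt.
have [i0 ci0] : exists i0, c u i0 != 0.
  apply/existsP; apply: contra_neqT u0 => /existsPn cu.
  apply/eqP; rewrite -dot_eq0; apply/eqP/(@complexI R).
  rewrite cD big1// => i _.
  by rewrite (eqP (negPn (cu i))) mul0r.
have ai i : c u i != 0 -> a i = 0.
  move=> /mulIf ci; apply/complexI/ci.
  by rewrite -cM uA c0 mul0r.
have ai0 := ai _ ci0.
have gap i : i != i0 -> lambda 2 A <= a i.
  by rewrite leNgt; apply: contra_neqN => /le2; apply; rewrite ai0.
have cx0 : c x i0 = 0.
  have := cD x u; rewrite xu (bigD1 i0)//= big1 ?addr0 => [/esym/eqP|i ii0].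
    by rewrite mulf_eq0 conjC_eq0 (negbTE ci0) orbF => /eqP.
  have [-> //|/ai a0] := eqVneq (c u i) 0; first by rewrite conjC0 mulr0.
  by have := gap _ ii0; rewrite a0 leNgt l2.
rewrite -lecR rmorphM/= !cD mulr_sumr; apply: ler_sum => i _.
rewrite cM -mulrA; have [->|/gap ii0] := eqVneq i i0.
  by rewrite cx0 mul0r !mulr0.
by rewrite ler_wpM2r ?mul_conjC_ge0// lecR.
Qed.
End Spectral.

(** * Normalized Laplacians and inner products of block vectors *)

Section Laplacians.
Variable R : rcfType.

Lemma tr_normalized_laplacian n (W D : 'M[R]_n) : W^T = W -> D^T = D ->
  (normalized_laplacian W D)^T = normalized_laplacian W D.
Proof.
move=> WT DT; rewrite /normalized_laplacian linearB/= trmx1 !trmx_mul WT.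
by rewrite /diag_invsqrt map_trmx DT mulmxA.
Qed.

Lemma dot_normalized_laplacian n (W D : 'M[R]_n) (x y : 'rV[R]_n) : D^T = D ->
  dot (x *m normalized_laplacian W D) y =
  dot x y - dot (x *m diag_invsqrt D *m W) (y *m diag_invsqrt D).
Proof.
move=> DT; rewrite /dot trmx_mul /diag_invsqrt map_trmx DT.
rewrite /normalized_laplacian mulmxBr mulmx1 mulmxBl.
by rewrite !mulmxA !mxE.
Qed.

Lemma diag_invsqrt_diag n (r : 'rV[R]_n) :
  diag_invsqrt (diag_mx r) = diag_mx (\row_i (Num.sqrt (r 0 i))^-1).
Proof.
apply/matrixP => i j; rewrite !mxE; case: eqVneq => [->|_]; rewrite ?mulr1n//.
by rewrite !mulr0n sqrtr0 invr0.
Qed.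

Lemma diag_invsqrt_mxdiag n d (r : 'I_n -> R) :
  diag_invsqrt (\mxdiag_(i < n) (r i)%:M) =
  \mxdiag_(i < n) ((Num.sqrt (r i))^-1)%:M :> 'M[R]_(\sum_(i < n) d).
Proof.
have map_block (B : 'I_n -> 'I_n -> 'M[R]_d) :
    diag_invsqrt (\mxblock_(i, j) B i j) = \mxblock_(i, j) diag_invsqrt (B i j).
  by apply/matrixP => k l; rewrite !mxE.
rewrite /mxdiag map_block; apply/eq_mxblock => i j.
rewrite !conform_mx_id; case: eqVneq => _.
  rewrite -!diag_const_mx diag_invsqrt_diag; congr diag_mx.
  by apply/rowP => k; rewrite !mxE.
by apply/matrixP => k l; rewrite !mxE sqrtr0 invr0.
Qed.

Lemma dot_mxrow n d (x y : 'I_n -> 'rV[R]_d) :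
  dot (\mxrow_i x i) (\mxrow_i y i) = \sum_i dot (x i) (y i).
Proof. by rewrite /dot tr_mxrow mul_mxrow_mxcol summxE. Qed.

Lemma dotC n (x y : 'rV[R]_n) : dot x y = dot y x.
Proof. by rewrite !dotE; apply: eq_bigr => i _; rewrite mulrC. Qed.

Lemma dotBl n (x y z : 'rV[R]_n) : dot (x - y) z = dot x z - dot y z.
Proof. by rewrite /dot mulmxBl !mxE. Qed.

Lemma dotZl n a (x y : 'rV[R]_n) : dot (a *: x) y = a * dot x y.
Proof. by rewrite /dot -scalemxAl mxE. Qed.

(** * Euclidean geometry of unit vectors *)

Lemma enorm_dot d (u : 'cV[R]_d) : enorm u ^+ 2 = dot u^T u^T.
Proof.
rewrite sqr_sqrtr ?sumr_ge0// => [|i _]; last exact: sqr_ge0.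
by rewrite dotE; apply: eq_bigr => i _; rewrite !mxE expr2.
Qed.

Lemma orthogonal_dot d (Q : 'M[R]_d) (u v : 'cV[R]_d) : orthogonal_mx Q ->
  dot (Q *m u)^T (Q *m v)^T = dot u^T v^T.
Proof.
move=> oQ; rewrite /dot !trmxK trmx_mul -mulmxA [Q^T *m _]mulmxA oQ.
by rewrite mul1mx.
Qed.

Lemma orthogonal_enorm d (Q : 'M[R]_d) (u : 'cV[R]_d) : orthogonal_mx Q ->
  enorm (Q *m u) = enorm u.
Proof.
move=> oQ; apply/eqP; rewrite -(eqrXn2 (n := 2))// ?sqrtr_ge0//.
by rewrite !enorm_dot orthogonal_dot.
Qed.

Lemma enormB_sqr d (u v : 'cV[R]_d) :
  enorm (u - v) ^+ 2 = enorm u ^+ 2 + enorm v ^+ 2 - 2 * dot u^T v^T.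
Proof.
rewrite !enorm_dot linearB/= dotBl !(dotC _ (_ - _)) !dotBl (dotC v^T u^T).
ring.
Qed.

(** Expand the squared norms of [u - v] and [u + v], which are nonnegative. *)
Lemma unit_dot_bounds d (u v : 'cV[R]_d) : enorm u = 1 -> enorm v = 1 ->
  -1 <= dot u^T v^T <= 1.
Proof.
move=> u1 v1.
have dotNr (y : 'rV[R]_d) : dot y (- v)^T = - dot y v^T.
  by rewrite dotC linearN/= -scaleN1r dotZl dotC mulN1r.
have := enormB_sqr u v; have := enormB_sqr u (- v).
rewrite (enorm_dot (- v)) !dotNr (dotC (- v)^T) dotNr !opprK -enorm_dot u1 v1.
have := sqr_ge0 (enorm (u - v)); have := sqr_ge0 (enorm (u + v)).
by move=> h1 h2 h3 h4; apply/andP; split; lra.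
Qed.

(* With [c] the inner product of [u] and [v], all three inequalities are
   affine in [c], so they need only be checked at [c = 1] and [c = -1]. *)
Lemma unit_vectors_sqr d (u v : 'cV[R]_d) (f g m : R) :
  enorm u = 1 -> enorm v = 1 -> 0 <= f -> 0 <= g ->
  [/\ enorm (u - v) ^+ 2 <= 4,
      (f - g) ^+ 2 <= enorm (f *: u - g *: v) ^+ 2 &
      m ^+ 2 * enorm (u - v) ^+ 2 <=
        3 * (f - m) ^+ 2 + 3 * (g - m) ^+ 2
        + 3 * enorm (f *: u - g *: v) ^+ 2].
Proof.
move=> u1 v1 f0 g0; rewrite !enormB_sqr.
have /andP[] := unit_dot_bounds u1 v1.
rewrite !enorm_dot !linearZ/= !dotZl !(dotC _ (_ *: _)) !dotZl -!enorm_dot.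
rewrite (dotC v^T) u1 v1; set c := dot _ _ => c1 c2.
have fg : 0 <= f * g by exact: mulr_ge0.
split; [lra| nra |].
(* In the third inequality, right side minus left side equals half of [h1] plus three halves of
   [h2]. The sum of squares in [h1] is its value at [c = -1], the one in [h2] a third of its value
   at [c = 1]. *)
have h1 : 0 <= (1 - c) *
    ((g - f) ^+ 2 + (m - f - 2 * g) ^+ 2 + (m - g - 2 * f) ^+ 2).
  by apply: mulr_ge0; [lra | rewrite !addr_ge0 ?sqr_ge0].
have h2 : 0 <= (1 + c) * ((f - m) ^+ 2 + (g - m) ^+ 2 + (f - g) ^+ 2).
  by apply: mulr_ge0; [lra | rewrite !addr_ge0 ?sqr_ge0].
lra.
Qed.

(** * The graph Laplacian as a Dirichlet form *)

Variables (n : nat) (w : 'I_n -> 'I_n -> R).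
Hypothesis w_sym : forall i j, w i j = w j i.
Hypothesis w_ge0 : forall i j, 0 <= w i j.
Hypothesis degree_gt0 : forall i, 0 < degree w i.

Lemma sum_degreel (g : 'I_n -> R) :
  \sum_i \sum_j w i j * g i = \sum_i degree w i * g i.
Proof. by apply: eq_bigr => i _; rewrite mulr_suml. Qed.

Lemma sum_degreer (g : 'I_n -> R) :
  \sum_i \sum_j w i j * g j = \sum_i degree w i * g i.
Proof.
rewrite exchange_big -sum_degreel; apply: eq_bigr => i _.
by apply: eq_bigr => j _; rewrite w_sym.
Qed.

(** This is [D^{1/2} f]. The substitution cancels the normalization, so that the Laplacian becomes
    the Dirichlet form of [f] and the dot product becomes the degree-weighted one. *)
Definition degree_row (f : 'I_n -> R) : 'rV[R]_n :=
  \row_i (Num.sqrt (degree w i) * f i).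

Lemma sqrt_degree_neq0 i : Num.sqrt (degree w i) != 0.
Proof. by rewrite gt_eqF// sqrtr_gt0. Qed.

Lemma sqr_sqrt_degree i :
  Num.sqrt (degree w i) * Num.sqrt (degree w i) = degree w i.
Proof. by rewrite -expr2 sqr_sqrtr// ltW. Qed.

Lemma dot_degree_row f g :
  dot (degree_row f) (degree_row g) = \sum_i degree w i * (f i * g i).
Proof.
rewrite dotE; apply: eq_bigr => i _.
by rewrite !mxE mulrACA sqr_sqrt_degree.
Qed.

Lemma degree_row_invsqrt f :
  degree_row f *m diag_invsqrt (diag_mx (\row_i degree w i)) = \row_i f i.
Proof.
rewrite diag_invsqrt_diag mul_mx_diag; apply/rowP => i.
by rewrite !mxE mulrAC divff ?mul1r// sqrt_degree_neq0.
Qed.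

Lemma tr_graph_laplacian : (graph_laplacian w)^T = graph_laplacian w.
Proof.
apply: tr_normalized_laplacian; last exact: tr_diag_mx.
by apply/matrixP => i j; rewrite !mxE.
Qed.

Lemma dot_graph_laplacian f :
  dot (degree_row f *m graph_laplacian w) (degree_row f) =
  2^-1 * \sum_i \sum_j w i j * (f i - f j) ^+ 2.
Proof.
rewrite dot_normalized_laplacian ?tr_diag_mx// !degree_row_invsqrt.
rewrite dot_degree_row.
have -> : \sum_i \sum_j w i j * (f i - f j) ^+ 2 =
    \sum_i \sum_j w i j * f i ^+ 2 + \sum_i \sum_j w i j * f j ^+ 2
    - 2 * \sum_i \sum_j w i j * (f i * f j).
  rewrite mulr_sumr -big_split -sumrB; apply: eq_bigr => i _.
  rewrite mulr_sumr -big_split -sumrB; apply: eq_bigr => j _ /=; ring.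
rewrite sum_degreel sum_degreer dotE.
have -> : \sum_j ((\row_i f i) *m \matrix_(i, j) w i j) 0 j * (\row_i f i) 0 j
    = \sum_i \sum_j w i j * (f i * f j).
  rewrite exchange_big; apply: eq_bigr => j _.
  by rewrite !mxE mulr_suml; apply: eq_bigr => i _; rewrite !mxE; ring.
under eq_bigr do rewrite -expr2.
by lra.
Qed.

Lemma graph_laplacian_ker : degree_row (fun=> 1) *m graph_laplacian w = 0.
Proof.
rewrite mulmxBr mulmx1 !mulmxA degree_row_invsqrt diag_invsqrt_diag.
rewrite mul_mx_diag; apply/rowP => j; rewrite !mxE.
under eq_bigr do rewrite !mxE mul1r w_sym.
rewrite mulr1 -/(degree w j) -{2}sqr_sqrt_degree mulfK ?sqrt_degree_neq0//.
by rewrite subrr.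
Qed.

Lemma degree_row_surj (x : 'rV[R]_n) : exists f, x = degree_row f.
Proof.
exists (fun i => x 0 i / Num.sqrt (degree w i)); apply/rowP => i.
by rewrite mxE mulrCA divff ?mulr1// sqrt_degree_neq0.
Qed.

(** Apply [(a - b)^2 <= 2 a^2 + 2 b^2] on each edge to an eigenvector. The rounding uses this to
    bound [lambda1] by twice the ratio [lambda1 / lambda2]. *)
Lemma lambda2_graph_laplacian_le2 : 0 < lambda 2 (graph_laplacian w) ->
  lambda 2 (graph_laplacian w) <= 2.
Proof.
move=> l2.
(* With fewer than two vertices [lambda 2] would be the default 0. *)
have n1 : (1 < n)%N.
  rewrite ltnNge; apply: contraTN l2 => n1; rewrite -leNgt.
  by rewrite /lambda nth_default// size_eigenvalues// tr_graph_laplacian.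
have [x x0 xL] := lambda_eigenvector tr_graph_laplacian (n1 : (2.-1 < n)%N).
have [f fE] := degree_row_surj x.
have xx : 0 < dot x x.
  by rewrite lt0r dot_eq0 x0 dotE sumr_ge0// => i _; rewrite -expr2 sqr_ge0.
rewrite -(ler_pM2r xx) -dotZl -xL fE dot_graph_laplacian dot_degree_row.
have : \sum_i \sum_j w i j * (f i - f j) ^+ 2 <=
    \sum_i \sum_j w i j * (2 * f i ^+ 2) + \sum_i \sum_j w i j * (2 * f j ^+ 2).
  rewrite -big_split; apply: ler_sum => i _ /=.
  rewrite -big_split; apply: ler_sum => j _ /=.
  rewrite -mulrDr ler_wpM2l//; have := sqr_ge0 (f i + f j); nra.
rewrite sum_degreel (sum_degreer (fun j => 2 * f j ^+ 2)).
have -> : \sum_i degree w i * (2 * f i ^+ 2) =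
    2 * \sum_i degree w i * (f i * f i).
  by rewrite mulr_sumr; apply: eq_bigr => i _; ring.
lra.
Qed.

(** * The connection Laplacian as an energy of vector fields *)

Variables (d : nat) (rho : 'I_n -> 'I_n -> 'M[R]_d).
Hypothesis rho_orth : forall i j, w i j != 0 -> orthogonal_mx (rho i j).
Hypothesis rho_tr : forall i j, w i j != 0 -> rho j i = (rho i j)^T.

Definition block_degree_row (v : 'I_n -> 'cV[R]_d) : 'rV[R]_(\sum_(i < n) d) :=
  \mxrow_i (Num.sqrt (degree w i) *: (v i)^T).

Lemma block_degree_row_surj x : exists v, x = block_degree_row v.
Proof.
exists (fun i => (Num.sqrt (degree w i))^-1 *: (submxrow x i)^T).
rewrite -[LHS]submxrowK; apply/eq_mxrow => i.
by rewrite linearZ/= trmxK scalerA divff ?scale1r// sqrt_degree_neq0.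
Qed.

Lemma dot_block_degree_row v :
  dot (block_degree_row v) (block_degree_row v) =
  \sum_i degree w i * enorm (v i) ^+ 2.
Proof.
rewrite dot_mxrow; apply: eq_bigr => i _.
by rewrite enorm_dot dotZl dotC dotZl mulrA sqr_sqrt_degree.
Qed.

Lemma block_degree_row_invsqrt v :
  block_degree_row v *m diag_invsqrt (\mxdiag_(i < n) (degree w i)%:M) =
  \mxrow_i (v i)^T.
Proof.
rewrite diag_invsqrt_mxdiag mul_mxrow_mxdiag; apply/eq_mxrow => i.
by rewrite mul_mx_scalar scalerA mulVf ?scale1r// sqrt_degree_neq0.
Qed.

Lemma tr_degree_mxdiag :
  (\mxdiag_(i < n) (degree w i)%:M)^T =
  \mxdiag_(i < n) (degree w i)%:M :> 'M[R]_(\sum_(i < n) d).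
Proof. by rewrite tr_mxdiag; apply/eq_mxdiag => i; rewrite tr_scalar_mx. Qed.

Lemma tr_connection_laplacian :
  (connection_laplacian w rho)^T = connection_laplacian w rho.
Proof.
apply: tr_normalized_laplacian; last exact: tr_degree_mxdiag.
rewrite tr_mxblock; apply/eq_mxblock => i j.
rewrite linearZ/= w_sym; have [->|wij] := eqVneq (w i j) 0.
  by rewrite !scale0r.
by rewrite (rho_tr wij) trmxK.
Qed.

Lemma sum_connection v : \sum_i \sum_j w i j * enorm (rho i j *m v j) ^+ 2 =
  \sum_i degree w i * enorm (v i) ^+ 2.
Proof.
rewrite -(sum_degreer (fun j => enorm (v j) ^+ 2)).
apply: eq_bigr => i _; apply: eq_bigr => j _.
have [->|wij] := eqVneq (w i j) 0; first by rewrite !mul0r.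
by rewrite (orthogonal_enorm _ (rho_orth wij)).
Qed.

(** Expand the squares. As [rho i j] is an isometry on edges, both square terms sum to the
    degree-weighted norm of [v], and the cross terms give the weight matrix. *)
Lemma dot_connection_laplacian v :
  dot (block_degree_row v *m connection_laplacian w rho) (block_degree_row v) =
  2^-1 * \sum_i \sum_j w i j * enorm (v i - rho i j *m v j) ^+ 2.
Proof.
rewrite dot_normalized_laplacian ?tr_degree_mxdiag// !block_degree_row_invsqrt.
rewrite dot_block_degree_row mul_mxrow_mxblock dot_mxrow.
have -> : \sum_i \sum_j w i j * enorm (v i - rho i j *m v j) ^+ 2 =
    \sum_i \sum_j w i j * enorm (v i) ^+ 2 +
    \sum_i \sum_j w i j * enorm (rho i j *m v j) ^+ 2
    - 2 * \sum_i \sum_j w i j * dot (v i)^T (rho i j *m v j)^T.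
  rewrite mulr_sumr -big_split -sumrB; apply: eq_bigr => i _.
  rewrite mulr_sumr -big_split -sumrB; apply: eq_bigr => j _ /=.
  by rewrite enormB_sqr; ring.
rewrite sum_degreel sum_connection.
have -> : \sum_j dot (\sum_i (v i)^T *m (w i j *: rho i j)) (v j)^T =
    \sum_i \sum_j w i j * dot (v i)^T (rho i j *m v j)^T.
  rewrite exchange_big; apply: eq_bigr => j _.
  rewrite {1}/dot mulmx_suml summxE; apply: eq_bigr => i _.
  by rewrite /dot !trmxK -scalemxAr -scalemxAl mxE mulmxA.
by lra.
Qed.

(** * Rayleigh quotients, Poincare inequality and rounding to the sphere *)

Hypothesis n_gt0 : (0 < n)%N.

Lemma sum_degree_gt0 : 0 < \sum_i degree w i.
Proof.
rewrite lt0r psumr_neq0 => [|i _]; last exact: ltW.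
rewrite sumr_ge0 => [|i _]; last exact: ltW.
rewrite andbT; apply/hasP.
by exists (Ordinal n_gt0); rewrite ?mem_index_enum /=.
Qed.

Lemma sphere_volume (v : 'I_n -> 'cV[R]_d) : sphere_valued v ->
  \sum_i degree w i * enorm (v i) ^+ 2 = \sum_i degree w i.
Proof. by move=> v1; apply: eq_bigr => i _; rewrite v1 expr1n mulr1. Qed.

(** The frustration of [v] is the Rayleigh quotient of the connection Laplacian at
    [block_degree_row v]. *)
Lemma lambda1_le_frustration v : sphere_valued v ->
  lambda 1 (connection_laplacian w rho) <= frustration w rho v.
Proof.
move=> v1; have T0 := sum_degree_gt0.
have := lambda1_le_dot (block_degree_row v) tr_connection_laplacian.
rewrite dot_connection_laplacian dot_block_degree_row /frustration.
by rewrite sphere_volume// mulrA ler_pdivlMr.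
Qed.

Definition degree_mean (f : 'I_n -> R) : R :=
  (\sum_i degree w i * f i) / \sum_i degree w i.

Lemma variance_degree (f : 'I_n -> R) :
  \sum_i degree w i * (f i - degree_mean f) = 0 /\
  \sum_i degree w i * (f i - degree_mean f) ^+ 2 =
    \sum_i degree w i * f i ^+ 2 - degree_mean f ^+ 2 * \sum_i degree w i.
Proof.
set m := degree_mean f; have T0 := sum_degree_gt0.
have E : \sum_i degree w i * f i = m * \sum_i degree w i.
  by rewrite /m /degree_mean divfK// gt_eqF.
split.
  under eq_bigr do rewrite mulrBr; rewrite sumrB E mulr_sumr.
  by apply/eqP; rewrite subr_eq0; apply/eqP/eq_bigr => i _; rewrite mulrC.
have -> : \sum_i degree w i * (f i - m) ^+ 2 =
  \sum_i degree w i * f i ^+ 2 - 2 * m * (\sum_i degree w i * f i)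
  + m ^+ 2 * \sum_i degree w i.
  rewrite !mulr_sumr -sumrB -big_split; apply: eq_bigr => i _ /=; ring.
by rewrite E; ring.
Qed.

(** Subtracting the degree-weighted mean makes [f] orthogonal to the kernel vector [D^{1/2} 1] and
    leaves the differences along edges unchanged. *)
Lemma graph_poincare (f : 'I_n -> R) : 0 < lambda 2 (graph_laplacian w) ->
  lambda 2 (graph_laplacian w) *
    \sum_i degree w i * (f i - degree_mean f) ^+ 2 <=
  2^-1 * \sum_i \sum_j w i j * (f i - f j) ^+ 2.
Proof.
move=> l2; have [m0 _] := variance_degree f; set m := degree_mean f in m0 *.
have u0 : degree_row (fun=> 1) != 0.
  apply/eqP => /rowP/(_ (Ordinal n_gt0)); rewrite !mxE mulr1 => /eqP.
  by rewrite (negbTE (sqrt_degree_neq0 _)).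
have := lambda2_le_dot (x := degree_row (fun i => f i - m)) tr_graph_laplacian
  u0 graph_laplacian_ker l2.
rewrite !dot_degree_row dot_graph_laplacian.
under eq_bigr do rewrite mulr1.
move=> /(_ m0); under eq_bigr do rewrite -expr2.
move=> /le_trans; apply; rewrite ler_wpM2l//.
by apply: ler_sum => i _; apply: ler_sum => j _; rewrite opprB addrA subrK.
Qed.

Lemma frustration_ge0 v : 0 <= frustration w rho v.
Proof.
rewrite mulr_ge0// mulr_ge0 ?invr_ge0//; apply: sumr_ge0 => i _.
  by apply: sumr_ge0 => j _; rewrite mulr_ge0// sqr_ge0.
by rewrite mulr_ge0 ?sqr_ge0// ltW.
Qed.

Lemma spherical_rounding : (0 < d)%N -> 0 < lambda 2 (graph_laplacian w) ->
  exists2 u : 'I_n -> 'cV[R]_d, sphere_valued u &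
    frustration w rho u <=
      11 * (lambda 1 (connection_laplacian w rho) /
            lambda 2 (graph_laplacian w)).
Proof.
move=> d_gt0 l2; have l2_le2 := lambda2_graph_laplacian_le2 l2.
have T_gt0 := sum_degree_gt0.
have [|x x0 xL] := @lambda_eigenvector _ _ 1 _ tr_connection_laplacian.
  by rewrite sum_nat_const card_ord muln_gt0 n_gt0.
have [v xE] := block_degree_row_surj x.
have : 0 < dot x x.
  by rewrite lt0r dot_eq0 x0 dotE sumr_ge0// => i _; rewrite -expr2 sqr_ge0.
have : dot (x *m connection_laplacian w rho) x =
    lambda 1 (connection_laplacian w rho) * dot x x by rewrite xL dotZl.
rewrite xE dot_connection_laplacian dot_block_degree_row.
set S := \sum_i _ * _; set Q := \sum_i _; set l1 := lambda 1 _.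
set l := lambda 2 _ in l2 l2_le2 *.
move=> Ql1 S_gt0.
pose f i := enorm (v i).
have f_ge0 i : 0 <= f i by exact: sqrtr_ge0.
pose u i := if f i == 0 then delta_mx (Ordinal d_gt0) 0 else (f i)^-1 *: v i.
have u1 : sphere_valued u.
  move=> i; rewrite /u; apply/eqP; rewrite -(eqrXn2 (n := 2))// ?sqrtr_ge0//.
  rewrite expr1n enorm_dot; have [_|fi0] := eqVneq (f i) 0.
    rewrite trmx_delta dotE (bigD1 (Ordinal d_gt0))//= big1 => [|k k0].
      by rewrite mxE !eqxx mulr1 addr0.
    by rewrite mxE (negbTE k0) andbF mul0r.
  rewrite linearZ/= dotZl dotC dotZl -enorm_dot -/(f i).
  by rewrite mulrA -expr2 -exprMn mulVf// expr1n.
(* Where [f i] vanishes so does [v i], hence the choice of unit vector there is harmless. *)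
have vE i : v i = f i *: u i.
  rewrite /u; case: eqVneq => [fi0|fi0]; last by rewrite scalerA divff ?scale1r.
  rewrite fi0 scale0r; apply: trmx_inj; apply/eqP.
  by rewrite trmx0 -dot_eq0 -enorm_dot -/(f i) fi0 expr0n.
(* On an edge, [unit_vectors_sqr] applies to [u i] and [rho i j *m u j]. Off the edges every term is
   0. *)
have edge m i j :
   [/\ w i j * enorm (u i - rho i j *m u j) ^+ 2 <= w i j * 4,
      w i j * (f i - f j) ^+ 2 <= w i j * enorm (v i - rho i j *m v j) ^+ 2 &
      m ^+ 2 * (w i j * enorm (u i - rho i j *m u j) ^+ 2) <=
        w i j * (3 * (f i - m) ^+ 2) + w i j * (3 * (f j - m) ^+ 2)
        + 3 * (w i j * enorm (v i - rho i j *m v j) ^+ 2)].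
  have [->|wij] := eqVneq (w i j) 0; first by rewrite !mul0r !mulr0 !addr0.
  have u1' : enorm (rho i j *m u j) = 1.
    by rewrite (orthogonal_enorm _ (rho_orth wij)).
  have [h1 h2 h3] := unit_vectors_sqr m (u1 i) u1' (f_ge0 i) (f_ge0 j).
  rewrite !vE -scalemxAr; split; rewrite ?ler_wpM2l//.
  rewrite (mulrCA (m ^+ 2)) (mulrCA 3 (w i j)).
  by rewrite -!(mulrDr (w i j)) ler_wpM2l//.
pose m := degree_mean f; have [_] := variance_degree f.
rewrite -/m -[\sum_i _ * f i ^+ 2]/S.
have := graph_poincare f l2; rewrite -/m -/l.
set V := \sum_i _ * _ ^+ 2; set F := \sum_i \sum_j _.
set T := \sum_i _ in T_gt0 *.
move=> pV VE.
have FQ : F <= Q.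
  by apply: ler_sum => i _; apply: ler_sum => j _; case: (edge 0 i j).
pose N := \sum_i \sum_j w i j * enorm (u i - rho i j *m u j) ^+ 2.
have N4 : N <= 4 * T.
  rewrite mulr_sumr; apply: ler_sum => i _; rewrite [leRHS]mulrC mulr_suml.
  by apply: ler_sum => j _; case: (edge 0 i j).
(* Each of the two endpoints contributes [3 * V]. *)
have mN : m ^+ 2 * N <= 6 * V + 3 * Q.
  have -> : 6 * V = \sum_i \sum_j w i j * (3 * (f i - m) ^+ 2) +
                    \sum_i \sum_j w i j * (3 * (f j - m) ^+ 2).
    rewrite sum_degreel (sum_degreer (fun j => 3 * (f j - m) ^+ 2)).
    by rewrite -big_split mulr_sumr; apply: eq_bigr => i _ /=; ring.
  rewrite !mulr_sumr -!big_split; apply: ler_sum => i _ /=.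
  rewrite !mulr_sumr -!big_split; apply: ler_sum => j _ /=.
  by case: (edge m i j).
exists u => //; rewrite /frustration sphere_volume// -/T -/N.
have N_ge0 : 0 <= N.
  by apply: sumr_ge0 => i _; apply: sumr_ge0 => j _; rewrite mulr_ge0// sqr_ge0.
have Q_ge0 : 0 <= Q.
  by apply: sumr_ge0 => i _; apply: sumr_ge0 => j _; rewrite mulr_ge0// sqr_ge0.
set eta := 2^-1 * _.
have NE : N = 2 * eta * T by rewrite /eta mulrA divff ?mul1r ?divfK// gt_eqF.
have l1E : l1 = l1 / l * l by rewrite divfK// gt_eqF.
have l1_ge0 : 0 <= l1 by rewrite -(pmulr_lge0 _ S_gt0); lra.
set r := l1 / l in l1E *.
have r_ge0 : 0 <= r by rewrite divr_ge0// ltW.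
have eta_ge0 : 0 <= eta by rewrite !mulr_ge0// invr_ge0// ltW.
have eta_le2 : eta <= 2 by rewrite -(ler_pM2r T_gt0); lra.
(* Poincare gives [l * V <= F / 2 <= Q / 2 = l1 * S = r * l * S]; divide by [l]. *)
have VS : V <= r * S by rewrite -(ler_pM2l l2); nra.
(* [Q = 2 * l1 * S = 2 * r * l * S], and [l <= 2]. *)
have QS : Q <= 4 * r * S.
  have : r * l * S <= r * 2 * S by rewrite ler_wpM2r ?ler_wpM2l// ltW.
  nra.
(* By the variance identity [m^2 * T = S - V], so the left side is [m^2 * N]. *)
have : (S - V) * (2 * eta) <= 6 * V + 3 * Q.
  by apply: le_trans mN; rewrite VE NE; lra.
have : (S - r * S) * (2 * eta) <= (S - V) * (2 * eta).
  by apply: ler_wpM2r; [exact: mulr_ge0 | lra].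
move=> h1 h2.
(* [6 * V + 3 * Q <= (6 + 12) * r * S], then halve. *)
have : ((1 - r) * eta) * S <= (9 * r) * S by lra.
rewrite ler_pM2r// => h.
(* Adding [r * eta <= 2 * r] to [(1 - r) * eta <= 9 * r] gives the constant 11 without
   distinguishing whether [r < 1]. *)
have : r * eta <= r * 2 by rewrite ler_wpM2l.
lra.
Qed.

End Laplacians.

(** * The Cheeger-type bounds for the frustration constant *)

Unset Implicit Arguments.

Theorem theorem2p4 (R : realType) (n d : nat) (E : rel 'I_n)
  (w : 'I_n -> 'I_n -> R) (rho : 'I_n -> 'I_n -> 'M[R]_d)
  (d_ge1 : (1 <= d)%N)
  (E_sym : symmetric E) (E_irr : irreflexive E)
  (w_sym : forall i j, w i j = w j i)
  (w_pos : forall i j, E i j -> 0 < w i j)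
  (w_zero : forall i j, ~~ E i j -> w i j = 0)
  (degree_pos : forall i, 0 < degree w i)
  (rho_orth : forall i j, E i j -> orthogonal_mx (rho i j))
  (rho_inv : forall i j, E i j -> rho j i = invmx (rho i j))
  (lambda2_pos : 0 < lambda 2 (graph_laplacian w)) :
  lambda 1 (connection_laplacian w rho) <= frustration_constant w rho /\
  frustration_constant w rho <=
    44 * (lambda 1 (connection_laplacian w rho) / lambda 2 (graph_laplacian w)).
Proof.
have w_neq0 i j : w i j != 0 -> E i j.
  by apply: contraNT => /w_zero/eqP.
have w_ge0 i j : 0 <= w i j.
  by have [/w_pos/ltW|/w_zero->] := boolP (E i j).
have orth i j : w i j != 0 -> orthogonal_mx (rho i j).
  by move=> /w_neq0/rho_orth.
have rho_tr i j : w i j != 0 -> rho j i = (rho i j)^T.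
  move=> wij; rewrite rho_inv ?w_neq0//.
  have [_ u] := mulmx1_unit (orth _ _ wij).
  by rewrite -[RHS](mulmxK u) (orth _ _ wij) mul1mx.
(* On an empty graph [lambda 2] would be the default 0. *)
have n_gt0 : (0 < n)%N.
  rewrite lt0n; apply: contraTneq lambda2_pos => n0; rewrite -leNgt.
  by rewrite /lambda nth_default// size_eigenvalues ?n0// tr_graph_laplacian.
have [v v1 [-> v_min]] := frustration_constant_min w rho d_ge1.
split; first exact: lambda1_le_frustration.
have [u u1] := spherical_rounding w_sym w_ge0 degree_pos orth rho_tr n_gt0
  d_ge1 lambda2_pos.
move=> u_le; have := le_trans (v_min _ u1) u_le.
(* The minimum is between 0 and 11 times the ratio; the ratio is thus nonnegative, and 11 may be
   raised to 44. *)
have := frustration_ge0 w_ge0 degree_pos rho v; lra.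
Qed.
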